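(* Let $F\subset\mathbb{R}$ be a self similar set that admits a homogeneous generating IFS $\Phi$, with uniform contraction ratio $\alpha$, that satisfies the strong separation condition. Assume $0<\dim_H F<1$. If $g(x)=\lambda\cdot x+t$, with $\lambda\neq 0$ and $t\in\mathbb{R}$, satisfies $g(F)\subseteq F$, then $$\frac{\log\alpha}{\log|\lambda|}\in\mathbb{Q}.$$
   Context: $\dim_H$ denotes Hausdorff dimension. An IFS (iterated function system) here is a finite family $\Phi=\{\phi_i\}_{i=1}^l$, $l\ge 2$, of maps $\phi_i:\mathbb{R}\to\mathbb{R}$ of the form $\phi_i(x)=\alpha_i x+t_i$ with $\alpha_i\in(0,1)$ (the contraction ratio of $\phi_i$) and $t_i\in\mathbb{R}$. The attractor of $\Phi$ is the unique nonempty compact set $F\subset\mathbb{R}$ with $F=\bigcup_{i=1}^l\phi_i(F)$; one says that $\Phi$ is a generating IFS for $F$, and $F$ is then called a self similar set. $\Phi$ is homogeneous if all its maps have the same contraction ratio, which is then called the uniform contraction ratio. $\Phi$ satisfies the strong separation condition if $\phi_i(F)\cap\phi_j(F)=\emptyset$ for all $i\ne j$. *)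

(* Defs.v *)
From HB Require Import structures.
From mathcomp Require Import all_boot all_order all_algebra.
From mathcomp Require Import all_classical all_reals all_analysis.

Set Implicit Arguments.
Unset Strict Implicit.
Unset Printing Implicit Defensive.

Import Order.TTheory GRing.Theory Num.Theory.
Import numFieldNormedType.Exports.

Local Open Scope classical_set_scope.
Local Open Scope ring_scope.

Definition diameter (R : realType) (A : set R) : \bar R :=
  ereal_sup [set `|x - y|%:E | x in A & y in A].

(* The summand |U|^s of a cover. The case split makes the empty set contribute
   0 (its diameter is -oo), so that countable covers include finite ones. *)
Definition hausdorff_gauge (R : realType) (s : R) (U : set R) : \bar R :=
  if U == set0 then 0%E else poweR (diameter U) s.

Definition hausdorff_content (R : realType) (s delta : R) (A : set R) :
    \bar R :=
  ereal_inf [set (\sum_(0 <= n <oo) hausdorff_gauge s (U n))%E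
    | U in [set U : nat -> set R |
        (forall n, (diameter (U n) <= delta%:E)%E)
        /\ A `<=` \bigcup_n U n]].

(* The limit as delta -> 0+ is a supremum, by monotonicity in delta. *)
Definition hausdorff_measure (R : realType) (s : R) (A : set R) : \bar R :=
  ereal_sup [set hausdorff_content s delta A
    | delta in [set delta : R | 0 < delta]].

Definition hausdorff_dim (R : realType) (A : set R) : \bar R :=
  ereal_inf [set s%:E
    | s in [set s : R | 0 <= s /\ hausdorff_measure s A = 0%E]].

Record ifs (R : realType) := Ifs {
  ifs_size : nat;
  ifs_ratio : 'I_ifs_size -> R;
  ifs_trans : 'I_ifs_size -> R;
  ifs_size_ge2 : (2 <= ifs_size)%N;
  ifs_ratio_itv : forall i, 0 < ifs_ratio i < 1
}.

Definition ifs_map (R : realType) (Phi : ifs R) (i : 'I_(ifs_size Phi))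
    (x : R) : R :=
  ifs_ratio i * x + ifs_trans i.

Definition is_attractor (R : realType) (Phi : ifs R) (F : set R) : Prop :=
  [/\ F !=set0, compact F &
      F = \bigcup_(i in [set: 'I_(ifs_size Phi)]) (ifs_map i @` F)].

Definition homogeneous_ifs (R : realType) (Phi : ifs R) (alpha : R) : Prop :=
  forall i : 'I_(ifs_size Phi), ifs_ratio i = alpha.

(* F is meant to be the attractor of Phi. *)
Definition strong_separation (R : realType) (Phi : ifs R) (F : set R) : Prop :=
  forall i j : 'I_(ifs_size Phi), i != j ->
    ifs_map i @` F `&` ifs_map j @` F = set0.

(* Main.v *)
(* Let E be the set of affine maps x |-> r x + b with r > 0 sending F into F.

   E is discrete. If g, h in E are distinct and close, h^-1 g is close to the
   identity; blow up to the scale where its displacement is comparable to the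
   gaps of F. There it cannot nearly preserve F (lemma rigidity), so a fixed
   proportion of the cylinders of that scale contain a point sent by g away
   from h(F). Hence, at finer scales, the cylinders met by g(F) or h(F)
   outnumber those met by h(F) by a fixed proportion of all cylinders. On the
   other hand every cylinder met by g(F) lies in a coarser one met by h(F), and
   the proportion of level n cylinders met by h(F) is nonincreasing in n, so
   past some scale nearly nothing can be gained: a contradiction.

   Let g in E have ratio r < 1. For each k, let w be the deepest cylinder map,
   up to a bounded number of levels, whose image of F contains g^k(F). The maps
   w^-1 g^k belong to E, with ratio r^k / alpha^n in a compact subset of
   ]0, +oo[. They have a cluster point, which is in E since F is closed, hence
   by discreteness two of them have the same ratio: r^i / alpha^m =
   r^j / alpha^n with i < j. For negative lambda, apply this to g o g. *)

Require Import Defs.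
From HB Require Import structures.
From mathcomp Require Import all_boot all_order all_algebra.
From mathcomp Require Import all_classical all_reals all_analysis.
From mathcomp Require Import zify ring lra.

Set Implicit Arguments.
Unset Strict Implicit.
Unset Printing Implicit Defensive.

Import Order.TTheory GRing.Theory Num.Theory.
Import numFieldNormedType.Exports.

Local Open Scope classical_set_scope.
Local Open Scope ring_scope.

(** * Powers of a ratio, and counting of words by prefixes *)

Lemma geometric_scale (R : realType) (a x : R) :
  0 < a < 1 -> 0 < x <= 1 -> exists n, a ^+ n.+1 < x <= a ^+ n.
Proof.
move=> /andP[a0 a1] /andP[x0 x1].
have ex : exists n, a ^+ n < x.
  have : a ^+ n @[n --> \oo] --> (0 : R).
    by apply: cvg_expr; rewrite gtr0_norm.
  move=> /cvgrPdist_lt/(_ _ x0)[n _ /(_ n (leqnn n))] /=.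
  by rewrite sub0r normrN gtr0_norm ?exprn_gt0//; exists n.
case: (ex_minnP ex) => -[|n] nx nmin.
  by move: nx; rewrite expr0 ltNge x1.
exists n; rewrite nx /= leNgt; apply/negP => /nmin.
by rewrite ltnn.
Qed.

Lemma expr_le_pos (R : realType) (a e : R) :
  0 < a < 1 -> 0 < e -> exists n, a ^+ n <= e.
Proof.
move=> a01 e0; have [e1|/ltW e1] := leP e 1.
  have [n /andP[+ _]] := @geometric_scale _ _ e a01 (introT andP (conj e0 e1)).
  by move=> /ltW; exists n.+1.
by exists 0%N; rewrite expr0.
Qed.

(* With l branches and c n the number of cylinders of level n met by a set,
   the proportion c n / l ^ n cannot lose l ^ - B infinitely often. *)
Lemma no_loss_scale (c : nat -> nat) (l B : nat) : (0 < l)%N ->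
  exists n, forall m, (B <= n + m)%N ->
    (c n * l ^ m < c (n + m) + l ^ (n + m - B))%N.
Proof.
move=> l0; apply: contrapT => loss.
have {}loss n : exists m, (c (n + m) * l ^ B + l ^ (n + m) <= c n * l ^ m * l ^ B)%N.
  apply: contrapT => nloss; apply: loss; exists n => m Bnm.
  rewrite ltnNge; apply/negP => le; apply: nloss; exists m.
  by rewrite -[in (l ^ (n + m))%N](subnK Bnm) expnD -mulnDl leq_mul2r le orbT.
(* Each loss lowers [c n / l ^ n] by at least [l ^ - B]; this is the resulting bound after [k]
   losses, with denominators cleared. *)
have iter k : exists n, (c n * l ^ B + k * l ^ n <= c 0 * l ^ B * l ^ n)%N.
  elim: k => [|k [n IH]]; first by exists 0%N; rewrite mul0n addn0 muln1.
  have [m le] := loss n; exists (n + m)%N.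
  rewrite mulSn addnA; apply: leq_trans (leq_add le (leqnn _)) _.
  have := leq_mul IH (leqnn (l ^ m)).
  by rewrite expnD !mulnA mulnDl [(_ * l ^ m * l ^ B)%N]mulnAC.
have [n] := iter (c 0 * l ^ B).+1.
rewrite leqNgt => /negP; apply; apply: (@leq_trans ((c 0 * l ^ B).+1 * l ^ n)).
  by rewrite ltn_pmul2r// expn_gt0 l0.
exact: leq_addl.
Qed.

(** A word of [S] is a prefix taken from [T] followed by [m] free letters. *)
Lemma card_prefix (I : finType) n m (S : {set (n + m).-tuple I})
    (T : {set n.-tuple I}) :
  (forall w, w \in S -> exists2 v : n.-tuple I, v \in T & take n w = v) ->
  (#|S| <= #|T| * #|I| ^ m)%N.
Proof.
move=> ST; pose f (u : n.-tuple I * m.-tuple I) := [tuple of u.1 ++ u.2].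
have /subset_leq_card/leq_trans : S \subset f @: finset.setX T [set: m.-tuple I]%SET.
  apply/fintype.subsetP => w /ST[v vT wv].
  have sz : size (drop n w) == m by rewrite size_drop size_tuple addKn.
  apply/imsetP; exists (v, Tuple sz); first by rewrite finset.in_setX vT finset.in_setT.
  by apply: val_inj; rewrite /= -wv cat_take_drop.
apply; apply: leq_trans (leq_imset_card _ _) _.
by rewrite cardsX cardsT card_tuple.
Qed.

(** * Cylinders and the gaps between them *)

Section Cylinders.
Variables (R : realType) (I : finType) (a : R) (t : I -> R) (F : set R).
Hypothesis a01 : 0 < a < 1.

Definition branch (i : I) (x : R) : R := a * x + t i.

(** The first letter is the outermost branch, so prefixes index coarser cylinders. *)
Definition cylinder (w : seq I) (x : R) : R := foldr branch x w.

Hypothesis F_stable : forall i x, F x -> F (branch i x).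
Hypothesis F_cover : forall x, F x -> exists i, exists2 y, F y & x = branch i y.

Let a0 : 0 < a. Proof. by case/andP: a01. Qed.

Let an0 n : 0 < a ^+ n. Proof. exact: exprn_gt0. Qed.

Lemma cylinderE w x : cylinder w x = a ^+ size w * x + cylinder w 0.
Proof.
elim: w => [|i w IH] /=; first by rewrite expr0; ring.
by rewrite /branch IH exprS; ring.
Qed.

Lemma cylinderB w x y : cylinder w x - cylinder w y = a ^+ size w * (x - y).
Proof. by rewrite cylinderE [cylinder w y]cylinderE; ring. Qed.

Lemma cylinder_in w x : F x -> F (cylinder w x).
Proof. by move=> Fx; elim: w => //= i w; exact: F_stable. Qed.

Lemma cylinder_cat w v x : cylinder (w ++ v) x = cylinder w (cylinder v x).
Proof. by rewrite /cylinder foldr_cat. Qed.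

Lemma cylinder_cover n x : F x ->
  exists w : n.-tuple I, exists2 y, F y & x = cylinder w y.
Proof.
elim: n x => [|n IH] x Fx; first by exists [tuple], x.
have [i [y Fy ->]] := F_cover Fx; have [w [z Fz ->]] := IH _ Fy.
by exists [tuple of i :: w], z.
Qed.

Variable delta : R.
Hypothesis delta0 : 0 < delta.
Hypothesis F_gap : forall i j x y, i != j -> F x -> F y ->
  delta <= `|branch i x - branch j y|.

(** At the first differing letter the pieces are [delta] apart; the common prefix scales this by a
    power of [a] that is at least [a ^+ size w]. *)
Lemma cylinder_gap w v x y : size w = size v -> w != v -> F x -> F y ->
  a ^+ size w * delta <= `|cylinder w x - cylinder v y|.
Proof.
have [_ a1] := andP a01.
elim: w v => [|i w IH] [|j v] //= [sz] wv Fx Fy.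
have [ij|ij] := eqVneq i j.
  have -> : branch i (cylinder w x) - branch j (cylinder v y) =
      a * (cylinder w x - cylinder v y) by rewrite ij /branch; ring.
  rewrite normrM gtr0_norm// exprS -mulrA ler_pM2l//; apply: IH => //.
  by move: wv; rewrite ij eqseq_cons eqxx.
apply: le_trans (F_gap ij (cylinder_in w Fx) (cylinder_in v Fy)).
rewrite -[leRHS]mul1r ler_pM2r//.
by apply: exprn_ile1; exact: ltW.
Qed.

(** * Affine maps that nearly preserve [F] *)

Variables p q : R.
Hypotheses (Fp : F p) (Fq : F q).
Hypothesis F_hull : forall x, F x -> p <= x <= q.
Variables (i0 j0 : I) (u0 v0 : R).
Hypotheses (ij0 : i0 != j0) (Fu0 : F u0) (Fv0 : F v0).
Hypothesis gap0 : `|branch i0 u0 - branch j0 v0| = delta.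

Let D := q - p.

Lemma dist_le_diam x y : F x -> F y -> `|x - y| <= D.
Proof.
by move=> /F_hull/andP[? ?] /F_hull/andP[? ?]; rewrite /D ler_norml; lra.
Qed.

Lemma gap_le_diam : delta <= D.
Proof. by rewrite -gap0; apply: dist_le_diam; exact: F_stable. Qed.

Let D0 : 0 < D. Proof. exact: lt_le_trans gap_le_diam. Qed.

(* The hypothesis is tested on a pair realizing the diameter, on a pair
   realizing the gap, and on the two endpoints of F. *)
Lemma rigidity (r b d eta : R) : 0 <= r -> d + eta < delta ->
  (forall x, F x -> `|r * x + b - x| <= d) ->
  (forall x, F x -> exists2 y, F y & `|r * x + b - y| <= eta) ->
  forall x, F x -> `|r * x + b - x| <= eta * (1 + 2 * D / delta).
Proof.
move=> r0 deta fd feta x Fx.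
have [p' Fp' pp'] := feta _ Fp.
have [q' Fq' qq'] := feta _ Fq.
have [u' Fu' uu'] := feta _ (F_stable i0 Fu0).
have [v' Fv' vv'] := feta _ (F_stable j0 Fv0).
have rD : r * D <= D + 2 * eta.
  move: (F_hull Fp') (F_hull Fq') pp' qq' => /andP[? ?] /andP[? ?].
  rewrite !ler_norml => /andP[? ?] /andP[? ?].
  have -> : r * D = (r * q + b) - (r * p + b) by rewrite /D; ring.
  by rewrite /D; lra.
(* A point of another branch is at least [delta] away from [branch i z], which exceeds [d + eta]; so
   the approximating point stays in branch [i]. *)
have stay i z z' : F z -> F z' -> `|r * branch i z + b - z'| <= eta ->
    exists2 y, F y & z' = branch i y.
  move=> Fz Fz' zz'; have [k [y Fy z'E]] := F_cover Fz'.
  have [->|ki] := eqVneq i k; first by exists y.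
  have := F_gap ki Fz Fy; rewrite -z'E => far.
  have := fd _ (F_stable i Fz).
  have := ler_distD (r * branch i z + b) (branch i z) z'.
  rewrite (distrC (branch i z) (_ + b)) => *; exfalso; lra.
have [u1 Fu1 u'E] := stay _ _ _ Fu0 Fu' uu'.
have [v1 Fv1 v'E] := stay _ _ _ Fv0 Fv' vv'.
have rdelta : delta <= r * delta + 2 * eta.
  have := F_gap ij0 Fu1 Fv1; rewrite -u'E -v'E => uv'.
  have : `|(r * branch i0 u0 + b) - (r * branch j0 v0 + b)| = r * delta.
    by rewrite -gap0 -[r in RHS](ger0_norm r0) -normrM; congr (`|_|); ring.
  move=> <-.
  have := ler_distD (r * branch i0 u0 + b) u' v'.
  have := ler_distD (r * branch j0 v0 + b) (r * branch i0 u0 + b) v'.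
  by rewrite (distrC u' (_ + b)); lra.
have eta0 : 0 <= eta by apply: le_trans pp'.
(* For [r >= 1] the diameter bound [rD] serves, with [delta <= D]; for [r < 1], the gap bound
   [rdelta]. *)
have r1 : `|r - 1| * delta <= 2 * eta.
  have := gap_le_diam; have [r_ge1|r_lt1] := leP 1 r => dD.
    rewrite ger0_norm ?subr_ge0//.
    have : (r - 1) * delta <= (r - 1) * D by rewrite ler_wpM2l ?subr_ge0.
    by lra.
  by rewrite ltr0_norm ?subr_lt0//; lra.
have r2 z z' : F z -> F z' -> `|(r - 1) * (z - z')| <= eta * (2 * D / delta).
  move=> Fz Fz'; rewrite normrM !mulrA ler_pdivlMr// mulrAC.
  rewrite [eta * 2]mulrC; apply: ler_pM => //; first by rewrite mulr_ge0// ltW.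
  exact: dist_le_diam.
rewrite [eta * (1 + _)]mulrDr mulr1.
(* Comparison with [p], whose image is at least [p - eta], bounds the displacement from below;
   comparison with [q] bounds it from above. *)
move: (r2 _ _ Fx Fp) (r2 _ _ Fx Fq) pp' qq' (F_hull Fp') (F_hull Fq').
set K := eta * _; rewrite !ler_norml => /andP[? ?] /andP[? ?] /andP[? ?] /andP[? ?].
move=> /andP[? ?] /andP[? ?].
by apply/andP; split; lra.
Qed.

(* rigidity, for (x |-> r' x + b')^-1 o (x |-> r x + b) read in the cylinder w. *)
Lemma hole (r b r' b' eta z : R) (w : seq I) : 0 < r' -> 0 <= r ->
  eta < delta / 2 ->
  (forall x, F x -> `|(r * cylinder w x + b) - (r' * cylinder w x + b')| <=
     r' * a ^+ size w * (delta / 2)) ->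
  F z -> r' * a ^+ size w * (eta * (1 + 2 * D / delta)) <
    `|(r * cylinder w z + b) - (r' * cylinder w z + b')| ->
  exists2 x, F x & forall y, F y ->
    r' * a ^+ size w * eta < `|(r * cylinder w x + b) - (r' * y + b')|.
Proof.
move=> r'0 r0 etad close Fz; apply: contraPP => nhole; apply/negP.
have near x : F x -> exists2 y, F y &
    `|(r * cylinder w x + b) - (r' * y + b')| <= r' * a ^+ size w * eta.
  move=> Fx; apply: contrapT => far; apply: nhole; exists x => // y Fy.
  by rewrite ltNge; apply/negP => ?; apply: far; exists y.
set s := r' * a ^+ size w in near close *.
have s0 : 0 < s by rewrite mulr_gt0.
(* [x |-> r / r' * x + c] is the map of the second affine map's inverse after the first, conjugated
   by [cylinder w]. *)
pose c := ((r * cylinder w 0 + b - b') / r' - cylinder w 0) / a ^+ size w.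
have cE x y : r / r' * x + c - y =
    ((r * cylinder w x + b) - (r' * cylinder w y + b')) / s.
  rewrite /c /s (cylinderE w x) (cylinderE w y).
  by field; rewrite !gt_eqF.
have cle x y e : (`|r / r' * x + c - y| <= e) =
    (`|(r * cylinder w x + b) - (r' * cylinder w y + b')| <= s * e).
  by rewrite cE normrM normfV (gtr0_norm s0) ler_pdivrMr// [s * e]mulrC.
rewrite -leNgt -cle; apply: (@rigidity _ _ (delta / 2)) => //.
- exact: divr_ge0 (ltW r'0).
- lra.
- by move=> x Fx; rewrite cle; exact: close.
move=> x Fx; have [y Fy gxhy] := near _ Fx.
have [v [y0 Fy0 yE]] := cylinder_cover (size w) Fy.
have sv : size w = size v by rewrite size_tuple.
(* If [v] differs from [w], the gap [s * delta] contradicts [close] and [gxhy], since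
   [eta < delta / 2]. *)
have [wv|wv] := eqVneq w v.
  by exists y0 => //; rewrite cle wv -yE -wv.
have := cylinder_gap sv wv Fx Fy0; rewrite -yE => far.
have {far}far : s * delta <= `|(r' * cylinder w x + b') - (r' * y + b')|.
  have -> : (r' * cylinder w x + b') - (r' * y + b') = r' * (cylinder w x - y).
    by ring.
  by rewrite normrM (gtr0_norm r'0) -mulrA ler_pM2l.
have := ler_distD (r * cylinder w x + b) (r' * cylinder w x + b') (r' * y + b').
rewrite (distrC (r' * _ + _) (r * _ + _)); have := close _ Fx.
have : s * eta < s * (delta / 2) by rewrite ltr_pM2l.
move=> *; exfalso; lra.
Qed.

(** The absolute value of an affine function on [[p, q]] is largest at an end, and both ends are in
    [F]. *)
Lemma affine_extremal (k c : R) :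
  exists2 x0, F x0 & forall x, F x -> `|k * x + c| <= `|k * x0 + c|.
Proof.
have le x : F x -> `|k * x + c| <= Num.max `|k * p + c| `|k * q + c|.
  move=> /F_hull/andP[px xq]; rewrite le_max; apply/orP.
  have [k0|/ltW k0] := leP 0 k; have [kx0|/ltW kx0] := leP 0 (k * x + c).
  - right; rewrite ger0_norm//; apply: le_trans (ler_norm _).
    by rewrite lerD2r ler_wpM2l.
  - left; rewrite ler0_norm// -normrN; apply: le_trans (ler_norm _).
    by rewrite lerN2 lerD2r ler_wpM2l.
  - left; rewrite ger0_norm//; apply: le_trans (ler_norm _).
    by rewrite lerD2r ler_wnM2l.
  - right; rewrite ler0_norm// -normrN; apply: le_trans (ler_norm _).
    by rewrite lerN2 lerD2r ler_wnM2l.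
have [pq|qp] := leP `|k * p + c| `|k * q + c|.
  by exists q => // x /le; rewrite max_r.
by exists p => // x /le; rewrite max_l// ltW.
Qed.

(** * Cylinders met by affine images of [F] *)

Definition self_affine (r b : R) := forall x, F x -> F (r * x + b).

Lemma self_affine_le1 (r b : R) : 0 <= r -> self_affine r b -> r <= 1.
Proof.
move=> r0 gF; have := dist_le_diam (gF _ Fq) (gF _ Fp).
have -> : r * q + b - (r * p + b) = r * D by rewrite /D; ring.
by rewrite ger0_norm ?ger_pMl// mulr_ge0// ltW.
Qed.

Definition hits n (r b : R) : {set n.-tuple I} :=
  [set w : n.-tuple I | `[< exists x y, [/\ F x, F y & r * x + b = cylinder w y] >]].

Lemma mem_hits n (r b x y : R) (w : n.-tuple I) : F x -> F y ->
  r * x + b = cylinder w y -> w \in hits n r b.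
Proof. by move=> Fx Fy e; rewrite inE; apply/asboolP; exists x, y. Qed.

(** Two points closer than the level [n] gap lie in the same level [n] cylinder. *)
Lemma hits_prefix n m (r b r' b' : R) (w : (n + m).-tuple I) :
  self_affine r' b' ->
  (forall x, F x -> `|(r * x + b) - (r' * x + b')| < a ^+ n * delta) ->
  w \in hits (n + m) r b -> exists2 v : n.-tuple I, v \in hits n r' b' & take n w = v.
Proof.
move=> hF close; rewrite inE => /asboolP[x [y [Fx Fy gx]]].
have [v [z Fz hx]] := cylinder_cover n (hF _ Fx).
exists v; first exact: mem_hits hx.
have st : size (take n w) = n by rewrite size_takel// size_tuple leq_addr.
apply/eqP/negPn/negP => wv.
have sv : size (take n w) = size v by rewrite st size_tuple.
have := cylinder_gap sv wv (cylinder_in (drop n w) Fy) Fz.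
rewrite -cylinder_cat cat_take_drop -gx -hx st => far.
by have := close _ Fx; rewrite ltNge far.
Qed.

(** Each word [w] gives a point whose image is far from the image of [F] under the second map. The
    [C] further levels make cylinders so short that these images occupy distinct cylinders, none met
    by the second map. [N] is tied by an equation so that it can be given another form. *)
Lemma hits_gain (m0 C k : nat) (r b r' b' eta : R) (u : m0.-tuple I) :
  0 < r' -> r' / 2 <= r -> self_affine r b ->
  a ^+ C * D < r' * delta / 2 -> a ^+ C * D <= r' * eta ->
  (forall w : k.-tuple I, exists2 x, F x & forall y, F y ->
    r' * a ^+ (m0 + k) * eta < `|(r * cylinder (u ++ w) x + b) - (r' * y + b')|) ->
  forall N, (m0 + k + C)%N = N -> forall T : {set N.-tuple I},
  hits N r b \subset T -> hits N r' b' \subset T ->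
  (#|hits N r' b'| + #|I| ^ k <= #|T|)%N.
Proof.
move=> r'0 rr' gF Cdelta Ceta holes N NE T gT hT.
have r0 : 0 < r by apply: lt_le_trans rr'; rewrite divr_gt0.
have /choice[X XP] : forall w : k.-tuple I, exists x, F x /\ forall y, F y ->
    r' * a ^+ (m0 + k) * eta < `|(r * cylinder (u ++ w) x + b) - (r' * y + b')|.
  by move=> w; have [x] := holes w; exists x.
have FX (w : k.-tuple I) : F (cylinder (u ++ w) (X w)).
  by apply: cylinder_in; case: (XP w).
pose P (w : k.-tuple I) := r * cylinder (u ++ w) (X w) + b.
have /choice[c cP] : forall w, exists c : N.-tuple I, exists2 y, F y & P w = cylinder c y.
  by move=> w; apply: cylinder_cover; exact: gF.
have aN y y' (v : N.-tuple I) : F y -> F y' ->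
    `|cylinder v y - cylinder v y'| <= a ^+ (m0 + k) * (a ^+ C * D).
  move=> Fy Fy'; rewrite cylinderB size_tuple -NE exprD -mulrA normrM gtr0_norm//.
  by rewrite ler_pM2l// normrM gtr0_norm// ler_pM2l// dist_le_diam.
have c_inj : injective c.
  move=> w w' cww'; apply/eqP/negPn/negP => ww'.
  have [y Fy Py] := cP w; have [y' Fy' Py'] := cP w'.
  have := aN _ _ (c w) Fy Fy'; rewrite -Py cww' -Py' leNgt => /negP; apply.
  have -> : P w - P w' = r * (cylinder (u ++ w) (X w) - cylinder (u ++ w') (X w')).
    by rewrite /P; ring.
  rewrite normrM (gtr0_norm r0).
  have sz (v : k.-tuple I) : size (u ++ v) = (m0 + k)%N by rewrite size_cat !size_tuple.
  have := @cylinder_gap (u ++ w) (u ++ w') (X w) (X w').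
  rewrite !sz eqseq_cat ?size_tuple// eqxx /= => /(_ erefl ww' (XP w).1 (XP w').1) far.
  apply: (@lt_le_trans _ _ (a ^+ (m0 + k) * (r' * delta / 2))).
    by rewrite ltr_pM2l.
  apply: (@le_trans _ _ (r * (a ^+ (m0 + k) * delta))); last by rewrite ler_pM2l.
  have : r' / 2 * (a ^+ (m0 + k) * delta) <= r * (a ^+ (m0 + k) * delta).
    by rewrite ler_wpM2r// mulr_ge0// ltW.
  by apply: le_trans; rewrite le_eqVlt; apply/orP; left; apply/eqP; ring.
have disj : (hits N r' b' :&: c @: [set: k.-tuple I])%SET = finset.set0.
  apply/finset.setP => v; rewrite finset.in_setI finset.in_set0.
  apply/negP => /andP[+ /imsetP[w _ vE]].
  rewrite inE => /asboolP[x [y [Fx Fy hx]]].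
  have [y' Fy' Py'] := cP w.
  have [_ /(_ _ Fx)] := XP w; rewrite -/(P w) hx Py' vE ltNge => /negP; apply.
  apply: le_trans (aN _ _ _ Fy' Fy) _.
  by rewrite [r' * _]mulrC -mulrA ler_pM2l.
have cT : c @: [set: k.-tuple I]%SET \subset T.
  apply: fintype.subset_trans gT; apply/fintype.subsetP => _ /imsetP[w _ ->].
  by have [y Fy Py] := cP w; exact: mem_hits (FX w) Fy Py.
have <- : #|c @: [set: k.-tuple I]%SET| = (#|I| ^ k)%N.
  by rewrite card_imset// cardsT card_tuple.
by rewrite -cardsUI disj cards0 addn0 subset_leq_card// finset.subUset hT.
Qed.

(** * Discreteness of the affine maps sending [F] into itself *)

(** A distinct nearby map would gain [#|I| ^ (n - m0)] cylinders at level [n + C], a proportion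
    [#|I| ^ - (m0 + C)] of all of them; [no_loss_scale] forbids this beyond level [n1]. *)
Lemma self_affine_isolated (r' b' : R) : 0 < r' -> self_affine r' b' ->
  exists2 e, 0 < e & forall r b, self_affine r b ->
    `|r - r'| < e -> `|b - b'| < e -> r = r' /\ b = b'.
Proof.
move=> r'0 hF.
(* Chosen so that the displacement required by [hole] at level [n] is half of [a ^+ n.+1 * s], hence
   below [M / 2]. *)
pose eta := a * delta / 4 / (1 + 2 * D / delta).
have den0 : 1 < 1 + 2 * D / delta by rewrite ltrDl divr_gt0// mulr_gt0.
have adelta : a * delta < delta by case/andP: a01 => _ ?; rewrite gtr_pMl.
have eta0 : 0 < eta.
  by rewrite divr_gt0 ?(lt_trans ltr01 den0)// divr_gt0// mulr_gt0.
have eta_den : eta * (1 + 2 * D / delta) = a * delta / 4.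
  by rewrite /eta mulfVK// gt_eqF// (lt_trans ltr01).
have eta_delta : eta < delta / 2.
  have : eta * 1 < eta * (1 + 2 * D / delta) by rewrite ltr_pM2l.
  by rewrite eta_den; lra.
(* On a level [m0] cylinder the difference of the two maps then varies by at most [M / 2], so it
   stays at least [M / 2] on the one containing [x0]. *)
have [m0 am0] : exists n, a ^+ n <= 1 / 4 by apply: expr_le_pos => //; lra.
have [C] : exists n, a ^+ n <= r' * eta / D.
  by apply: expr_le_pos => //; rewrite divr_gt0// mulr_gt0.
rewrite ler_pdivlMr// => aC.
have I0 : (0 < #|I|)%N by apply/card_gt0P; exists i0.
have [n1 n1P] := @no_loss_scale (fun n => #|hits n r' b'|) _ (m0 + C) I0.
pose X := `|p| + `|q| + 1.
have FX x : F x -> `|x| + 1 <= X.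
  move=> /F_hull/andP[px xq]; rewrite /X lerD2r.
  have := ler_norm q; have := ler_norm (- p); rewrite normrN => *.
  by rewrite ler_norml; apply/andP; split;
    have := normr_ge0 p; have := normr_ge0 q; lra.
have X0 : 0 < X by apply: lt_le_trans (FX _ Fp); rewrite ltr_wpDl.
pose s := r' * (delta / 2).
have s0 : 0 < s by rewrite mulr_gt0// divr_gt0.
(* The first term gives [r' / 2 <= r]; the second makes [M] so small that its scale [n] exceeds
   [n1 + m0]. *)
pose e := Num.min (r' / 2) (a ^+ (n1 + m0).+1 * s / X).
have e0 : 0 < e by rewrite lt_min !divr_gt0// mulr_gt0.
exists e => // r b gF re be; apply: contrapT => neq.
have rr' : r' / 2 <= r.
  have : e <= r' / 2 by rewrite ge_min lexx.
  by move: re; rewrite ltr_norml => /andP[? ?]; lra.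
have r0 : 0 <= r by apply: le_trans rr'; rewrite divr_ge0// ltW.
have dE x : (r * x + b) - (r' * x + b') = (r - r') * x + (b - b') by ring.
have [x0 Fx0] := affine_extremal (r - r') (b - b').
set M := `|_ * x0 + _| => x0P.
have rD : `|r - r'| * D <= 2 * M.
  rewrite -[D]gtr0_norm// -normrM.
  have -> : (r - r') * D = ((r - r') * q + (b - b')) - ((r - r') * p + (b - b')).
    by rewrite /D; ring.
  by apply: le_trans (ler_normB _ _) _; have := x0P _ Fp; have := x0P _ Fq; lra.
have M0 : 0 < M.
  rewrite lt_neqAle normr_ge0 andbT eq_sym; apply/negP => /eqP M0; apply: neq.
  have rr : r = r'.
    apply/eqP; rewrite -subr_eq0 -normr_eq0 eq_le normr_ge0 andbT.
    by move: rD; rewrite M0 mulr0 pmulr_lle0.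
  split => //; move: M0 => /normr0_eq0; rewrite rr; lra.
have Ms : M < a ^+ (n1 + m0).+1 * s.
  apply: (@lt_le_trans _ _ (e * X)); last first.
    by rewrite -ler_pdivlMr// ge_min lexx orbT.
  apply: (@lt_le_trans _ _ (e * (`|x0| + 1))); last by rewrite ler_wpM2l ?FX ?ltW.
  rewrite mulrDr mulr1; apply: le_lt_trans (ler_normD _ _) _.
  by rewrite ler_ltD// normrM ler_wpM2r// ltW.
have a_le1 n : a ^+ n <= 1.
  by case/andP: a01 => *; apply: exprn_ile1; exact: ltW.
(* At this scale [M] is comparable to the gaps: the upper bound gives the closeness assumed in
   [hole], the lower bound its displacement. *)
have [n] : exists n, a ^+ n.+1 < M / s <= a ^+ n.
  apply: geometric_scale => //; rewrite divr_gt0//= ler_pdivrMr// mul1r ltW//.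
  by apply: lt_le_trans Ms _; rewrite ger_pMl.
rewrite ltr_pdivlMr// ler_pdivrMr// => /andP[Mlo Mhi].
have n1n : (n1 + m0 < n)%N.
  have := lt_trans Mlo Ms; rewrite ltr_pM2r// ltr_iXn2l ?a0//; last by case/andP: a01.
have nE : (m0 + (n - m0))%N = n by clear -n1n; lia.
have [u [x1 Fx1 x0E]] := cylinder_cover m0 Fx0.
have holes (w : (n - m0).-tuple I) : exists2 x, F x & forall y, F y ->
    r' * a ^+ (m0 + (n - m0)) * eta < `|(r * cylinder (u ++ w) x + b) - (r' * y + b')|.
  have szE : size (u ++ w) = (m0 + (n - m0))%N by rewrite size_cat !size_tuple.
  have sz : size (u ++ w) = n by rewrite szE nE.
  rewrite -szE; apply: (@hole _ _ _ _ _ p) => //; rewrite ?sz.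
    move=> x Fx; rewrite dE//; apply: le_trans (x0P _ (cylinder_in _ Fx)) _.
    by rewrite [r' * _]mulrC -mulrA.
  rewrite eta_den dE// cylinder_cat; set z := cylinder w p.
  have Fz : F z by exact: cylinder_in.
  have : `|(r - r') * (x0 - cylinder u z)| <= M / 2.
    rewrite x0E cylinderB size_tuple mulrCA normrM gtr0_norm// normrM.
    apply: (@le_trans _ _ (1 / 4 * (2 * M))); last lra.
    apply: ler_pM => //; first exact: ltW.
    by apply: le_trans rD; rewrite ler_wpM2l// dist_le_diam.
  have -> : (r - r') * (x0 - cylinder u z) =
      ((r - r') * x0 + (b - b')) - ((r - r') * cylinder u z + (b - b')) by ring.
  have := lerB_dist ((r - r') * x0 + (b - b')) ((r - r') * cylinder u z + (b - b')).
  rewrite -/M.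
  have : r' * a ^+ n * (a * delta / 4) = a ^+ n.+1 * s / 2.
    by rewrite /s exprS; field.
  move=> -> *; lra.
have NE : (m0 + (n - m0) + C)%N = (n1 + (n + C - n1))%N by clear -n1n; lia.
have := n1P (n + C - n1)%N.
have -> : (n1 + (n + C - n1) - (m0 + C))%N = (n - m0)%N by clear -n1n; lia.
rewrite ltnNge => /(_ _)/negP; apply; first by clear -n1n; lia.
apply: leq_trans (hits_gain r'0 rr' gF _ aC holes NE
  (T := (hits _ r b :|: hits _ r' b')%SET) _ _) _.
- by apply: le_lt_trans aC _; rewrite -mulrA ltr_pM2l.
- exact: finset.subsetUl.
- exact: finset.subsetUr.
(* The maps differ by less than [a ^+ n1 * delta] on [F], so every cylinder of the union refines one
   of level [n1] met by the second map. *)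
apply: card_prefix => w; rewrite finset.in_setU => /orP[] wh.
  apply: hits_prefix wh => // x Fx; rewrite dE//; apply: le_lt_trans (x0P _ Fx) _.
  apply: lt_le_trans Ms _.
  apply: (@le_trans _ _ (a ^+ n1 * s)).
    by rewrite ler_pM2r// -addnS exprD ger_pMr.
  rewrite ler_pM2l// /s; have := self_affine_le1 (ltW r'0) hF => r'1.
  apply: (@le_trans _ _ (1 * (delta / 2))); last lra.
  by rewrite ler_wpM2r// divr_ge0// ltW.
by apply: hits_prefix wh => // x Fx; rewrite subrr normr0 mulr_gt0.
Qed.

(** * Renormalization and recurrence of ratios *)

Hypothesis F_closed : closed F.

Lemma self_affine_cluster (s : nat -> R * R) (r' b' : R) :
  (forall k, self_affine (s k).1 (s k).2) ->
  (forall e N, 0 < e -> exists2 k, (N <= k)%N &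
     `|(s k).1 - r'| < e /\ `|(s k).2 - b'| < e) ->
  self_affine r' b'.
Proof.
move=> sF s_cl x Fx; apply: F_closed => U /nbhs_ballP[e /= e0 eU].
have X0 : 0 < `|x| + 1 by rewrite ltr_wpDl.
have [|k _ [rk bk]] := s_cl (e / (`|x| + 1)) 0%N; first by rewrite divr_gt0.
exists ((s k).1 * x + (s k).2); split; first exact: sF.
apply: eU; rewrite /ball /= distrC.
have -> : (s k).1 * x + (s k).2 - (r' * x + b') = ((s k).1 - r') * x + ((s k).2 - b').
  by ring.
apply: le_lt_trans (ler_normD _ _) _.
have -> : e = e / (`|x| + 1) * `|x| + e / (`|x| + 1) by field; rewrite gt_eqF.
by rewrite ler_ltD// normrM ler_wpM2r// ltW.
Qed.

(** Take the last level [n] with [r * D <= a ^+ n * delta / 2]. The image is shorter than the gaps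
    of that level, so it lies in one cylinder, whose map can be inverted; failure at level [n.+1]
    gives the lower bound. *)
Lemma renormalize (r b : R) : 0 < r -> r * D <= delta / 2 -> self_affine r b ->
  exists n c, self_affine (r / a ^+ n) c /\ a * delta / (2 * D) <= r / a ^+ n.
Proof.
move=> r0 rD gF; have den0 : 0 < delta / 2 by rewrite divr_gt0.
have [n] : exists n, a ^+ n.+1 < r * D / (delta / 2) <= a ^+ n.
  by apply: geometric_scale => //; rewrite divr_gt0 ?mulr_gt0//= ler_pdivrMr ?mul1r.
rewrite ltr_pdivlMr// ler_pdivrMr// => /andP[lo hi].
have [w [y0 Fy0 gpE]] := cylinder_cover n (gF _ Fp).
exists n, ((b - cylinder w 0) / a ^+ n); split; last first.
  rewrite ler_pdivlMr// mulrAC ler_pdivrMr ?mulr_gt0//.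
  by move: lo; rewrite exprS => lo; lra.
move=> x Fx; have [v [y Fy gxE]] := cylinder_cover n (gF _ Fx).
have szE (u : n.-tuple I) : size u = n by rewrite size_tuple.
have [wv|wv] := eqVneq (w : seq I) v.
  suff -> : r / a ^+ n * x + (b - cylinder w 0) / a ^+ n = y by [].
  have -> : r / a ^+ n * x + (b - cylinder w 0) / a ^+ n =
      (r * x + b - cylinder w 0) / a ^+ n by ring.
  by rewrite gxE -wv (cylinderE w y) szE; field; rewrite gt_eqF.
have := cylinder_gap (etrans (szE w) (esym (szE v))) wv Fy0 Fy.
rewrite szE -gpE -gxE.
have -> : r * p + b - (r * x + b) = r * (p - x) by ring.
rewrite normrM gtr0_norm// leNgt => /negP[].
apply: (@le_lt_trans _ _ (r * D)); first by rewrite ler_pM2l// dist_le_diam.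
apply: le_lt_trans hi _; rewrite ltr_pM2l//; lra.
Qed.

Lemma self_affine_iter (r b : R) k : self_affine r b ->
  exists c, self_affine (r ^+ k) c.
Proof.
move=> gF; elim: k => [|k [c kF]].
  by exists 0 => x; rewrite expr0 mul1r addr0.
exists (r * c + b) => x /kF/gF.
by congr F; rewrite exprS; ring.
Qed.

Lemma self_affine_ratio_commensurable (r b : R) : 0 < r < 1 -> self_affine r b ->
  exists i j m n, (i < j)%N /\ r ^+ i / a ^+ m = r ^+ j / a ^+ n.
Proof.
move=> r01 gF; have r0 : 0 < r by case/andP: r01.
(* Starting at exponent [N] makes every power small enough for [renormalize]. *)
have [N] : exists N, r ^+ N <= delta / 2 / D.
  by apply: expr_le_pos => //; rewrite !divr_gt0.
rewrite ler_pdivlMr// => rN.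
have /choice[n nP] : forall k, exists n, exists c,
    self_affine (r ^+ (N + k) / a ^+ n) c /\
    a * delta / (2 * D) <= r ^+ (N + k) / a ^+ n.
  move=> k; have [c kF] := self_affine_iter (N + k) gF.
  apply: renormalize kF; first exact: exprn_gt0.
  apply: le_trans rN; rewrite ler_pM2r// exprD ger_pMr ?exprn_gt0//.
  by case/andP: r01 => *; apply: exprn_ile1; exact: ltW.
have /choice[c cP] := nP.
pose s k : R * R := (r ^+ (N + k) / a ^+ n k, c k).
(* [lo] keeps the cluster ratio positive, as isolation requires. [B] bounds the translations: each
   is the image of [p], in [[p, q]], minus [p] times a ratio at most 1. *)
pose lo := a * delta / (2 * D); pose B : R := `|p| + `|q| + `|p|.
have s1 k : lo <= (s k).1 <= 1.
  have [sF slo] := cP k; rewrite slo; apply: self_affine_le1 sF.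
  by rewrite divr_ge0// ltW// exprn_gt0.
have s2 k : - B <= (s k).2 <= B.
  have [sF _] := cP k; have [s0 sle1] := andP (s1 k).
  have lo0 : 0 <= lo by rewrite ltW// divr_gt0 ?mulr_gt0.
  rewrite -ler_norml.
  have -> : (s k).2 = ((s k).1 * p + (s k).2) - (s k).1 * p by ring.
  apply: le_trans (ler_normB _ _) _; apply: lerD.
    move: (F_hull (sF _ Fp)) => /andP[? ?].
    have := ler_norm q; have := ler_norm (- p); rewrite normrN => *.
    by rewrite ler_norml; apply/andP; split;
      have := normr_ge0 p; have := normr_ge0 q; rewrite /s /=; lra.
  by rewrite normrM ger0_norm ?(le_trans lo0)// ler_piMl.
have cpt := compact_setX (@segment_compact R lo 1) (@segment_compact R (- B) B).
have [] := cpt (s @ \oo) _ _.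
  by exists 0%N => // k _; split; rewrite /= in_itv /=; [exact: s1|exact: s2].
move=> [r' b'] [[/= + _] cl]; rewrite in_itv /= => /andP[r'lo _].
have r'0 : 0 < r' by apply: lt_le_trans r'lo; rewrite divr_gt0 ?mulr_gt0.
have {}cl e M : 0 < e -> exists2 k, (M <= k)%N &
    `|(s k).1 - r'| < e /\ `|(s k).2 - b'| < e.
  move=> e0; have := cl [set s k | k in [set k | (M <= k)%N]] (ball (r', b') e).
  case.
  - by exists M => // k Mk; exists k.
  - exact: nbhsx_ballx.
  - by move=> _ [[k Mk <-] [/= B1 B2]]; exists k => //; split; rewrite distrC.
have hF : self_affine r' b'.
  by apply: (@self_affine_cluster s) => // k; case: (cP k).
have [e e0 iso] := self_affine_isolated r'0 hF.
have rE k : `|(s k).1 - r'| < e /\ `|(s k).2 - b'| < e -> (s k).1 = r'.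
  by move=> [? ?]; have [] := iso (s k).1 (s k).2 (cP k).1.
have [i _ /rE iE] := cl e 0%N e0.
(* Searching from [i.+1] makes the two indices distinct, while isolation gives both terms the ratio
   [r']. *)
have [j ij /rE jE] := cl e i.+1 e0.
exists (N + i)%N, (N + j)%N, (n i), (n j).
by rewrite ltn_add2l; split => //; rewrite -[LHS]/(s i).1 iE -jE.
Qed.

End Cylinders.

(** * Logarithms, extrema on compact sets, and the conclusion *)

(** Logarithms give [(j - i) * ln r = (n - m) * ln a]; as [i < j] and [ln r] is nonzero, [n] and [m]
    differ. *)
Lemma rational_log_ratio (R : realType) (a r : R) (i j m n : nat) :
  0 < a < 1 -> 0 < r < 1 -> (i < j)%N -> r ^+ i / a ^+ m = r ^+ j / a ^+ n ->
  rational (ln a / ln r).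
Proof.
move=> /[dup] a01 /andP[a0 a1] /[dup] r01 /andP[r0 r1] ij /(congr1 (@ln R)).
have lnE k l : ln (r ^+ k / a ^+ l) = k%:R * ln r - l%:R * ln a.
  by rewrite ln_div ?posrE ?exprn_gt0// !lnXn// !mulr_natl.
rewrite !lnE.
have := ln_lt0 a01; have := ln_lt0 r01.
set A := ln a; set L := ln r => L0 A0 e.
have {}e : (j%:R - i%:R) * L = (n%:R - m%:R) * A by lra.
have nm0 : (n%:R - m%:R : R) != 0.
  apply/eqP => nm; move: e; rewrite nm mul0r => /eqP.
  rewrite mulf_eq0 (lt_eqF L0) orbF subr_eq0 eqr_nat => /eqP ji.
  by move: ij; rewrite ji ltnn.
exists ((j%:R - i%:R) / (n%:R - m%:R)) => //.
rewrite fmorph_div !rmorphB !rmorph_nat.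
by apply/eqP; rewrite eqr_div ?(lt_eqF L0)// e mulrC.
Qed.

Lemma compact_hull (R : realType) (F : set R) : F !=set0 -> compact F ->
  exists p q, [/\ F p, F q & forall x, F x -> p <= x <= q].
Proof.
move=> F0 cF; have idF : {within F, continuous (@id R)}.
  by apply: continuous_subspaceT => x; exact: cvg_id.
have [p /set_mem Fp pP] := compact_EVT_min F0 cF idF.
have [q /set_mem Fq qP] := compact_EVT_max F0 cF idF.
exists p, q; split=> // x /mem_set Fx.
by apply/andP; split; [exact: pP|exact: qP].
Qed.

(** Minimize over [F * F] by compactness for each pair of letters, then over the finitely many
    pairs. The gap must be attained for [rigidity]. *)
Lemma compact_gap (R : realType) (F : set R) (I : finType) (f : I -> R -> R)
    (i0 j0 : I) :
  F !=set0 -> compact F -> (forall i, continuous (f i)) -> i0 != j0 ->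
  exists i j x y, [/\ i != j, F x, F y & forall i' j' x' y', i' != j' ->
    F x' -> F y' -> `|f i x - f j y| <= `|f i' x' - f j' y'|].
Proof.
move=> F0 cF cf ij0.
have /choice[z zP] : forall k : I * I, exists z : R * R, [/\ F z.1, F z.2 &
    forall x y, F x -> F y -> `|f k.1 z.1 - f k.2 z.2| <= `|f k.1 x - f k.2 y|].
  move=> [i j] /=.
  have c_dist : continuous (fun z : R * R => `|f i z.1 - f j z.2|).
    move=> z; apply: cvg_norm; apply: cvgB.
      by apply: continuous_comp; [exact: cvg_fst|exact: cf].
    by apply: continuous_comp; [exact: cvg_snd|exact: cf].
  have FF0 : F `*` F !=set0 by case: F0 => x Fx; exists (x, x).
  have [z /set_mem[Fz1 Fz2] zP] := compact_EVT_min FF0 (compact_setX cF cF)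
    (continuous_subspaceT c_dist).
  by exists z; split => // x y Fx Fy; apply: (zP (x, y)); exact: mem_set.
pose dist k := `|f k.1 (z k).1 - f k.2 (z k).2|.
have [[i j] /= ij kP] := @arg_minP _ _ _ (i0, j0)
  (fun k : I * I => k.1 != k.2) dist ij0.
have [Fx Fy _] := zP (i, j).
exists i, j, (z (i, j)).1, (z (i, j)).2; split => // i' j' x' y' ij' Fx' Fy'.
apply: le_trans (kP (i', j') ij') _.
by have [_ _] := zP (i', j'); exact.
Qed.

Theorem corollary1p3 (R : realType) (F : set R) (Phi : ifs R) (alpha : R)
    (hattr : is_attractor Phi F)
    (hhom : homogeneous_ifs Phi alpha)
    (hssc : strong_separation Phi F)
    (hdim0 : (0 < hausdorff_dim F)%E)
    (hdim1 : (hausdorff_dim F < 1)%E)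
    (lambda t : R) (hlambda : lambda != 0)
    (hg : (fun x : R => lambda * x + t) @` F `<=` F) :
  rational (ln alpha / ln `|lambda|).
Proof.
have [F0 cF FE] := hattr.
pose i0 : 'I_(ifs_size Phi) := Ordinal (ltnW (ifs_size_ge2 Phi)).
pose j0 : 'I_(ifs_size Phi) := Ordinal (ifs_size_ge2 Phi).
have a01 : 0 < alpha < 1 by rewrite -(hhom i0) ifs_ratio_itv.
have mapE i x : ifs_map i x = branch alpha (@ifs_trans R Phi) i x.
  by rewrite /ifs_map hhom.
have stable i x : F x -> F (branch alpha (@ifs_trans R Phi) i x).
  by move=> Fx; rewrite FE; exists i => //; exists x; rewrite ?mapE.
have cover x : F x -> exists i, exists2 y, F y &
    x = branch alpha (@ifs_trans R Phi) i y.
  by rewrite {1}FE => -[i _ [y Fy <-]]; exists i, y; rewrite ?mapE.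
have [p [q [Fp Fq hull]]] := compact_hull F0 cF.
have cont i : continuous (branch alpha (@ifs_trans R Phi) i).
  move=> x; apply: cvgD; last exact: cvg_cst.
  by apply: cvgM; [exact: cvg_cst|exact: cvg_id].
have [i1 [j1 [u0 [v0 [ij Fu Fv gap]]]]] :=
  @compact_gap _ _ _ _ i0 j0 F0 cF cont isT.
have gap0 : 0 < `|branch alpha (@ifs_trans R Phi) i1 u0 -
    branch alpha (@ifs_trans R Phi) j1 v0|.
  rewrite normr_gt0 subr_eq0; apply/eqP => uv.
  have : (ifs_map i1 @` F `&` ifs_map j1 @` F) (ifs_map i1 u0).
    by split; [exists u0|exists v0; rewrite // !mapE].
  by rewrite hssc.
have gF : self_affine F lambda t by move=> x Fx; apply: hg; exists x.
(* Squaring makes the ratio positive whatever the sign of [lambda]; the factor 2 in the final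
   witness undoes it. *)
have ggF : self_affine F (lambda ^+ 2) (lambda * t + t).
  by move=> x /gF/gF; congr F; ring.
have l0 : 0 < lambda ^+ 2 by rewrite exprn_even_gt0.
have ll : ln (lambda ^+ 2) = 2 * ln `|lambda|.
  by rewrite -real_normK ?num_real// lnXn ?normr_gt0// mulr_natl.
(* If [lambda] is 1 or -1, the denominator is 0, and division by 0 yields 0, which is rational. *)
have [l1|l1] := eqVneq (lambda ^+ 2) 1.
  have -> : ln `|lambda| = 0 by move: ll; rewrite l1 ln1; lra.
  by rewrite invr0 mulr0; exists 0 => //; rewrite rmorph0.
have F_closed : closed F by apply: compact_closed cF; exact: norm_hausdorff.
have r01 : 0 < lambda ^+ 2 < 1.
  rewrite l0 lt_neqAle l1 /=.
  exact: (self_affine_le1 stable gap0 Fp Fq hull Fu Fv erefl (ltW l0) ggF).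
have [i [j [m [n [ltij e]]]]] := self_affine_ratio_commensurable a01 stable cover
  gap0 gap Fp Fq hull ij Fu Fv erefl F_closed r01 ggF.
have [c _ cE] := rational_log_ratio a01 r01 ltij e.
exists (2 * c) => //; rewrite rmorphM rmorph_nat /= cE ll; field.
by move: (ln_lt0 r01); rewrite ll => ?; rewrite lt_eqF//; lra.
Qed.
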